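(* Let $n\ge 4$ and let $T$ be optimal in $\mathcal{T}_n$, the family of all trees of order $n$. Then the limbs of $T$ all have order $1$, i.e. every leaf of $T$ is adjacent to a vertex of degree at least $3$ in $T$.
   Context: The order of a graph is its number of vertices. A subtree of a tree $T$ is a nonempty connected subgraph. The mean subtree order $M_T$ is the average of the orders of all subtrees of $T$. A tree of maximum mean subtree order in a given family is called optimal in that family. A limb of $T$ is a maximal path in $T$ containing a leaf of $T$ and no vertices of degree greater than $2$ in $T$. *)

(* Defs.v *)
From mathcomp Require Import all_boot all_order all_algebra.
Set Implicit Arguments.
Unset Strict Implicit.
Unset Printing Implicit Defensive.

Record sgraph := SGraph {
  vertex :> finType;
  edge : rel vertex;
  edge_sym : symmetric edge;
  edge_irrefl : irreflexive edge }.

Definition degree (G : sgraph) (v : G) : nat := #|[set u | edge v u]|.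

Definition leaf (G : sgraph) (v : G) : bool := degree v == 1.

Definition connected_graph (G : sgraph) : Prop :=
  forall u v : G, connect (@edge G) u v.

(* The size bound excludes the empty sequence and the back-and-forth walk
   along one edge, both of which are ucycles of a symmetric relation. *)
Definition acyclic_graph (G : sgraph) : Prop :=
  forall c : seq G, 2 < size c -> ~ ucycle (@edge G) c.

Definition is_tree (G : sgraph) : Prop :=
  [/\ 0 < #|G|, connected_graph G & acyclic_graph G].

(* Vertex set and edge set; an edge {u, v} is encoded by the two ordered pairs
   (u, v) and (v, u), hence the symmetry clause in is_subgraph. *)
Notation subgraph G := ({set vertex G} * {set vertex G * vertex G})%type.

Definition is_subgraph (G : sgraph) (H : subgraph G) : bool :=
  [forall u, forall v, ((u, v) \in H.2) ==>
    [&& edge u v, u \in H.1, v \in H.1 & (v, u) \in H.2]].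

Definition subgraph_le (G : sgraph) (H K : subgraph G) : bool :=
  (H.1 \subset K.1) && (H.2 \subset K.2).

Definition subgraph_order (G : sgraph) (H : subgraph G) : nat := #|H.1|.

Definition connected_subgraph (G : sgraph) (H : subgraph G) : bool :=
  [forall u in H.1, forall v in H.1,
    connect [rel x y | (x, y) \in H.2] u v].

Definition subtree (G : sgraph) (H : subgraph G) : bool :=
  [&& is_subgraph H, H.1 != set0 & connected_subgraph H].

Definition mean_subtree_order (G : sgraph) : rat :=
  ((\sum_(H : subgraph G | subtree H) subgraph_order H)%N%:R
   / #|[set H : subgraph G | subtree H]|%:R)%R.

Definition trees_of_order (n : nat) (G : sgraph) : Prop :=
  is_tree G /\ #|G| = n.

Definition optimal (F : sgraph -> Prop) (G : sgraph) : Prop :=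
  F G /\
  forall G', F G' -> (mean_subtree_order G' <= mean_subtree_order G)%R.

Definition subgraph_of_seq (G : sgraph) (p : seq G) : subgraph G :=
  ([set x in p],
   [set u : G * G | infix [:: u.1; u.2] p || infix [:: u.2; u.1] p]).

Definition is_path (G : sgraph) (H : subgraph G) : Prop :=
  exists p : seq G,
    [/\ p != [::], uniq p, sorted (@edge G) p & H = subgraph_of_seq p].

Definition leaf_path (G : sgraph) (H : subgraph G) : Prop :=
  [/\ is_path H,
      exists2 v, v \in H.1 & leaf v
    & forall v, v \in H.1 -> degree v <= 2].

Definition limb (G : sgraph) (H : subgraph G) : Prop :=
  leaf_path H /\
  forall K : subgraph G, leaf_path K -> subgraph_le H K -> K = H.

(* Main.v *)
Require Import Defs.
From mathcomp Require Import all_boot all_order all_algebra.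
From mathcomp Require Import lra.
Set Implicit Arguments.
Unset Strict Implicit.
Unset Printing Implicit Defensive.
Import Order.TTheory GRing.Theory Num.Theory.

(** A leaf whose neighbour has degree 2 can be moved so as to raise the mean
    subtree order; hence no optimal tree has one.

    Let v be a leaf of a tree T of order at least 4, with a neighbour u whose
    only other neighbour is w, and let R be the rest of the tree.  Let T' be
    obtained by replacing the edge vu with vw, so that u and v both become
    leaves hanging from w.  Write a and A for the number and the total order of
    the subtrees of R containing w, and t and M for the number and the total
    order of all subtrees of R.  Then

      T  has t + 2a + 3 subtrees, of total order M + 2A + 3a + 4,
      T' has t + 3a + 2 subtrees, of total order M + 3A + 4a + 2,

    and T' has the larger mean if and only if
    M (1 - a) + A (t + 5) + t (a - 2) - a^2 - 2a - 2 > 0.  This follows from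
    a >= 2, t >= a, M >= A, A >= 2a - 1 and Jamison's inequality
    M / t <= A / a: the mean order of the subtrees through a fixed vertex is at
    least the mean order of all subtrees.  (See pendant_path_vs_cherry.)

    Jamison's inequality is proved by induction together with the auxiliary
    bounds, cutting a tree at an edge wc (acyclic_split).  Subtrees are
    identified with connected vertex sets (sum_subtree), and numbers and total
    orders are the values at 1 of a generating polynomial and of its
    derivative.  When R1 and R2 are joined by the single edge wc, a connected
    set meeting both parts is a pair of a connected set through w and one
    through c, which gives the two product formulas rooted_poly_join and
    subtree_poly_join.  They drive the induction (rooted_bounds_join), and also
    count the subtrees of T and T' starting from those of R. *)

(** * Connected vertex sets *)

Section ConnectedSets.
Variable T : finType.
Implicit Types (e : rel T) (S R : {set T}).

Definition within e S : rel T := fun x y => [&& x \in S, y \in S & e x y].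
#[global] Arguments within e S x y /.

Definition connected_set e S : bool :=
  (S != set0) && [forall x in S, forall y in S, connect (within e S) x y].

Lemma connected_setP e S :
  reflect (S != set0 /\ {in S &, forall x y, connect (within e S) x y})
          (connected_set e S).
Proof.
apply: (iffP andP) => -[S0 cS]; split=> //.
  by move=> x y xS yS; move/forall_inP: cS => /(_ x xS)/forall_inP; apply.
by apply/forall_inP => x xS; apply/forall_inP => y yS; apply: cS.
Qed.

Lemma connected_set0 e : connected_set e set0 = false.
Proof. by rewrite /connected_set eqxx. Qed.

Lemma connected_set1 e x : connected_set e [set x].
Proof.
apply/connected_setP; split; first by apply/set0Pn; exists x; rewrite inE.
by move=> y z /set1P -> /set1P ->.
Qed.

Lemma eq_connected_set e e' S :
  {in S &, forall x y, e x y = e' x y} ->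
  connected_set e S = connected_set e' S.
Proof.
move=> ee'; congr (_ && _); apply: eq_forallb_in => x _.
apply: eq_forallb_in => y _; apply: eq_connect => a b /=.
by case aS: (a \in S); case bS: (b \in S) => //=; apply: ee'.
Qed.

Lemma connect_homo (T' : finType) (r : rel T) (r' : rel T') (f : T -> T') :
  (forall x y, r x y -> connect r' (f x) (f y)) ->
  forall x y, connect r x y -> connect r' (f x) (f y).
Proof.
move=> rr' x y /connectP[p + ->]; elim: p x => //= z p IHp x /andP[xz zp].
exact: connect_trans (rr' _ _ xz) (IHp _ zp).
Qed.

(** Connectedness passes to a retract: each edge of S is mapped by f to a walk
    in S'.  The maps used collapse one side of a bridge to an endpoint. *)
Lemma connected_set_retract e S S' (f : T -> T) :
  connected_set e S -> S' != set0 -> S' \subset S -> {in S', f =1 id} ->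
  {in S &, forall x y, e x y -> connect (within e S') (f x) (f y)} ->
  connected_set e S'.
Proof.
case/connected_setP=> _ cS S'0 /subsetP sS fid fE.
apply/connected_setP; split=> // x y xS yS.
rewrite -(fid x xS) -(fid y yS).
apply: (connect_homo _ (cS x y (sS _ xS) (sS _ yS))).
by move=> a b /and3P[]; apply: fE.
Qed.

Definition joined e (R1 R2 : {set T}) w c :=
  [/\ [disjoint R1 & R2], w \in R1, c \in R2 &
      {in R1 & R2, forall x y, e x y = (x == w) && (y == c)}].

Lemma joined_sym e R1 R2 w c :
  symmetric e -> joined e R1 R2 w c -> joined e R2 R1 c w.
Proof.
move=> se [d wR cR E]; split=> //; first by rewrite disjoint_sym.
by move=> x y xR yR; rewrite se E // andbC.
Qed.

(** The map collapsing S2 to w is a retraction onto S1, since the only edge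
    leaving S1 starts at w. *)
Lemma joined_connected_part e R1 R2 w c S1 S2 :
  symmetric e -> joined e R1 R2 w c -> S1 \subset R1 -> S2 \subset R2 ->
  w \in S1 -> connected_set e (S1 :|: S2) -> connected_set e S1.
Proof.
move=> se [/pred0P d wR cR E] /subsetP s1 /subsetP s2 wS cS.
have S1N x : x \in S1 -> x \in S2 -> False.
  by move=> /s1 x1 /s2 x2; have := d x; rewrite /= x1 x2.
pose f x := if x \in S1 then x else w.
apply: (@connected_set_retract e _ _ f cS).
- by apply/set0Pn; exists w.
- exact: subsetUl.
- by move=> x xS; rewrite /f xS.
move=> x y; rewrite !inE /f; case: ifP => /= xS; case: ifP => /= yS.
- by move=> _ _ exy; apply: connect1; rewrite /= xS yS.
- by move=> _ yS2; rewrite E ?s1 ?s2 // => /andP[/eqP->].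
- by move=> xS2 _; rewrite se E ?s1 ?s2 // => /andP[/eqP->].
- by [].
Qed.

(** This is what makes generating functions multiply along a bridge: a
    connected set with vertices on both sides must use the edge wc, and splits
    freely into a connected set through w and a connected set through c. *)
Lemma connected_set_join e R1 R2 w c S1 S2 :
  symmetric e -> joined e R1 R2 w c -> S1 \subset R1 -> S2 \subset R2 ->
  S1 != set0 -> S2 != set0 ->
  connected_set e (S1 :|: S2) =
  [&& w \in S1, connected_set e S1, c \in S2 & connected_set e S2].
Proof.
move=> se J s1 s2 S10 S20; have J' := joined_sym se J.
apply/idP/idP => [cS|/and4P[wS cS1 cS cS2]].
  have [/pred0P d wR cR E] := J.
  have [wS cS2] : w \in S1 /\ c \in S2.
    have /connected_setP[_ con] := cS.
    have [x xS] := set0Pn _ S10; have [y yS] := set0Pn _ S20.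
    have := con x y; rewrite !inE xS yS orbT => /(_ isT isT) xy.
    apply/andP/negPn/negP => Nwc; move: xy.
    have cl : closed (within e (S1 :|: S2)) (mem S1).
      apply: intro_closed.
        by apply: sym_connect_sym => a b; rewrite /= se andbCA.
      move=> a b /and3P[_]; rewrite inE => /orP[//|bS] eab aS.
      move: eab; rewrite E ?(subsetP s1 a) ?(subsetP s2 b) //.
      by case/andP=> /eqP aw /eqP bc; move: Nwc; rewrite -aw -bc aS bS.
    move/(closed_connect cl); rewrite /= xS => /esym /(subsetP s1) y1.
    by have := d y; rewrite /= y1 (subsetP s2).
  rewrite wS cS2 (joined_connected_part se J s1 s2) //=.
  by apply: (joined_connected_part se J' s2 s1 cS2); rewrite setUC.
have [_ wR cR E] := J.
have lift (U : {set T}) : U \subset S1 :|: S2 -> forall x y,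
    connect (within e U) x y -> connect (within e (S1 :|: S2)) x y.
  move=> /subsetP sU; apply: connect_sub => x y /and3P[/sU xU /sU yU exy].
  by apply: connect1; rewrite /= xU yU.
have [[_ c1] [_ c2]] := (connected_setP _ _ cS1, connected_setP _ _ cS2).
have Cw x : x \in S1 :|: S2 -> connect (within e (S1 :|: S2)) x w.
  case/setUP => xS; first by apply: lift (c1 _ _ xS wS); apply: subsetUl.
  apply: connect_trans (lift _ (subsetUr _ _) _ _ (c2 _ _ xS cS)) _.
  by apply: connect1; rewrite /= !inE wS cS se E // !eqxx orbT.
apply/connected_setP; split.
  by apply/set0Pn; exists w; rewrite inE wS.
move=> x y xS yS; apply: connect_trans (Cw x xS) _.
rewrite (sym_connect_sym _) ?Cw // => a b.
by rewrite /= se andbCA.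
Qed.

Lemma sum_subsetU (V : nmodType) R1 R2 (F : {set T} -> V) :
  [disjoint R1 & R2] ->
  (\sum_(S : {set T} | S \subset R1 :|: R2) F S =
   \sum_(S1 : {set T} | S1 \subset R1) \sum_(S2 : {set T} | S2 \subset R2)
     F (S1 :|: S2))%R.
Proof.
move=> d; rewrite pair_big /=.
rewrite (reindex_onto (fun p : {set T} * {set T} => p.1 :|: p.2)
  (fun S => (S :&: R1, S :&: R2))) /=; last first.
  by move=> S sS; rewrite -setIUr; apply/setIidPl.
apply: eq_bigl => -[S1 S2] /=; apply/andP/andP.
  by case=> _ /eqP[<- <-]; rewrite !subsetIr.
move=> [s1 s2]; split; first exact: setUSS.
have d' (A B : {set T}) : A \subset R1 -> B \subset R2 -> A :&: B = set0.
  by move=> a b; apply/eqP; rewrite setI_eq0; exact: disjointW a b d.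
rewrite !setIUl (setIidPl s1) (setIidPl s2) (d' _ _ s1) //.
by rewrite (setIC S2) (d' _ _ (subxx _) s2) set0U setU0.
Qed.

End ConnectedSets.

Local Open Scope ring_scope.

(** * Generating polynomials of connected sets *)

Section SubtreePolynomials.
Variable T : finType.
Implicit Types (e : rel T) (S R : {set T}).

Definition subtree_poly e R : {poly rat} :=
  \sum_(S : {set T} | (S \subset R) && connected_set e S) 'X^#|S|.

Definition rooted_poly e R w : {poly rat} :=
  \sum_(S : {set T} | (S \subset R) && ((w \in S) && connected_set e S))
    'X^#|S|.

Lemma eq_subtree_poly e e' R :
  {in R &, forall x y, e x y = e' x y} -> subtree_poly e R = subtree_poly e' R.
Proof.
move=> ee'; apply: eq_bigl => S; case sS: (S \subset R) => //=.
by apply: eq_connected_set => x y /(subsetP sS) ? /(subsetP sS); apply: ee'.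
Qed.

Lemma eq_rooted_poly e e' R w :
  {in R &, forall x y, e x y = e' x y} ->
  rooted_poly e R w = rooted_poly e' R w.
Proof.
move=> ee'; apply: eq_bigl => S; case sS: (S \subset R) => //=.
congr (_ && _).
by apply: eq_connected_set => x y /(subsetP sS) ? /(subsetP sS); apply: ee'.
Qed.

Lemma subtree_poly1 e w : subtree_poly e [set w] = 'X.
Proof.
rewrite /subtree_poly (big_pred1 [set w]) ?cards1 // => S /=.
rewrite subset1; have [->|_] := eqVneq S [set w]; first exact: connected_set1.
by case: eqP => //= ->; exact: connected_set0.
Qed.

Lemma rooted_poly1 e w : rooted_poly e [set w] w = 'X.
Proof.
rewrite /rooted_poly (big_pred1 [set w]) ?cards1 // => S /=.
rewrite subset1; have [->|_] := eqVneq S [set w].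
  by rewrite set11 connected_set1.
by case: eqP => //= ->; rewrite inE.
Qed.

Section Join.
Variables (e : rel T) (R1 R2 : {set T}) (w c : T).
Hypotheses (se : symmetric e) (J : joined e R1 R2 w c).

Let cardsUd S1 S2 :
  S1 \subset R1 -> S2 \subset R2 -> #|S1 :|: S2| = (#|S1| + #|S2|)%N.
Proof.
have [d _ _ _] := J.
move=> s1 s2; apply/eqP; rewrite (leq_card_setU S1 S2).2.
exact: disjointW s1 s2 d.
Qed.

(** The summand 1 stands for the sets that stay in R1, that is, for an empty
    second part. *)
Lemma rooted_poly_join :
  rooted_poly e (R1 :|: R2) w = rooted_poly e R1 w * (1 + rooted_poly e R2 c).
Proof.
have [d wR cR E] := J.
rewrite /rooted_poly big_mkcondr sum_subsetU // big_distrl /= [RHS]big_mkcondr.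
apply: eq_bigr => S1 s1.
have wS2 S2 : S2 \subset R2 -> (w \in S2) = false.
  move=> /subsetP s2; apply/negP => /s2 wR2.
  by move/pred0P: d => /(_ w); rewrite /= wR wR2.
rewrite (bigD1 set0) ?sub0set //= setU0.
case: ifP => [/andP[wS cS]|NS]; last first.
  rewrite add0r big1 // => S2 /andP[s2 S20]; rewrite inE (wS2 S2) // orbF.
  case wS: (w \in S1) NS => //= NS; rewrite (connected_set_join se J) ?NS //.
    by rewrite andbF.
  by apply/set0Pn; exists w.
rewrite mulrDr mulr1; congr (_ + _); rewrite big_distrr /=.
rewrite [RHS]big_mkcondr [RHS](bigD1 set0) ?sub0set //= inE add0r.
apply: eq_bigr => S2 /andP[s2 S20].
rewrite inE wS /= (connected_set_join se J) ?wS ?cS //=; last first.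
  by apply/set0Pn; exists w.
by rewrite cardsUd // exprD.
Qed.

(** The three summands are the connected sets inside R1, those inside R2, and
    those that cross the edge wc. *)
Lemma subtree_poly_join :
  subtree_poly e (R1 :|: R2) =
  subtree_poly e R1 + subtree_poly e R2
  + rooted_poly e R1 w * rooted_poly e R2 c.
Proof.
have [d wR cR E] := J.
rewrite /subtree_poly /rooted_poly big_mkcondr sum_subsetU //.
rewrite (bigD1 set0) ?sub0set //=.
rewrite (eq_bigr (fun S2 : {set T} =>
  if connected_set e S2 then 'X^#|S2| else 0));
  last by move=> S2 _; rewrite set0U.
(* The term S1 = set0 has just become the sum over R2; now S2 = set0 gives the
   sum over R1, and pairs of nonempty sets give the product. *)
rewrite -big_mkcondr addrC [X in _ = X + _]addrC -[RHS]addrA [RHS]addrC.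
congr (_ + _).
rewrite [X in _ = X + _]big_mkcondr [X in _ = X + _](bigD1 set0) ?sub0set //=.
rewrite connected_set0 add0r big_distrl /= [X in _ = _ + X]big_mkcondr.
rewrite [X in _ = _ + X](bigD1 set0) ?sub0set //= inE add0r -big_split /=.
apply: eq_bigr => S1 /andP[s1 S10].
rewrite (bigD1 set0) ?sub0set //= setU0; congr (_ + _).
rewrite big_distrr /= [X in _ = if _ then X else _]big_mkcondr.
rewrite [X in _ = if _ then X else _](bigD1 set0) ?sub0set //= inE add0r.
case: ifP => [/andP[wS cS]|NS]; [apply: eq_bigr|apply: big1];
  move=> S2 /andP[s2 S20]; rewrite (connected_set_join se J) //.
  by rewrite wS cS /= cardsUd // exprD.
by rewrite andbA NS.
Qed.

End Join.
End SubtreePolynomials.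

(** * Trees *)

Section Acyclic.
Variable G : sgraph.
Hypothesis acG : acyclic_graph G.

(** A path of length at least 2 from x to y, closed by the edge yx, would be a
    cycle.  With r missing one chosen edge, this says that every edge of an
    acyclic graph is a bridge. *)
Lemma acyclic_chord (r : rel G) x y :
  subrel r (@edge G) -> connect r x y -> edge y x -> r x y.
Proof.
move=> sr /connectP[p xp ->]; case/shortenP: xp => -[|z [|t p']] //=.
- by rewrite edge_irrefl.
- by rewrite andbT.
move=> xp up _ eyx; case: (acG (c := x :: z :: t :: p')) => //.
apply/andP; split=> //; rewrite /cycle rcons_path; apply/andP; split=> //.
exact: (@sub_path _ _ _ sr x [:: z, t & p'] xp).
Qed.

(** Any edge wc inside R will do: R2 is the component of c in R minus w.  An
    edge from R2 to R1 ends in w by definition of a component, and it starts in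
    c because another one would close a cycle through w. *)
Lemma acyclic_split (R : {set G}) w :
  connected_set (@edge G) R -> w \in R -> R != [set w] ->
  exists c R1 R2, R = R1 :|: R2 /\ joined (@edge G) R1 R2 w c.
Proof.
move=> /connected_setP[_ cR] wR Rw.
have [x xR xw] : exists2 x, x \in R & x != w.
  apply/exists_inP; apply: contra_neqT Rw => /exists_inPn Nx.
  apply/setP => x; rewrite inE; apply/idP/eqP => [/Nx/negPn/eqP|->] //.
have [c /and3P[_ cinR ewc]] : exists c, within (@edge G) R w c.
  have /connectP[[|c p] /=] := cR _ _ wR xR.
    by move=> _ xw'; rewrite xw' eqxx in xw.
  by case/andP=> wc _ _; exists c.
have cw : c != w by apply: contraTneq ewc => ->; rewrite edge_irrefl.
pose r := within (@edge G) (R :\ w).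
have sr : connect_sym r.
  by apply: sym_connect_sym => a b; rewrite /r /= edge_sym andbCA.
pose R2 := [set z | connect r c z].
have R2R z : z \in R2 -> z \in R :\ w.
  rewrite inE => /connectP[p cp ->].
  case/lastP: p cp => [_|p y]; first by rewrite !inE cw.
  by rewrite rcons_path last_rcons => /andP[_ /and3P[]].
exists c, (R :\: R2), R2; split.
  have /setIidPr sR2 : R2 \subset R by apply/subsetP => z /R2R/setD1P[].
  by rewrite -{1}(setID R R2) sR2 setUC.
have NwR2 : w \notin R2 by apply/negP => /R2R; rewrite !inE eqxx.
split.
- by rewrite -setI_eq0 setDE -setIA (setIC (~: _)) setICr setI0.
- by rewrite inE NwR2.
- by rewrite inE connect0.
move=> y z /setDP[yR yN2] zR2; apply/idP/andP => [eyz|[/eqP-> /eqP->]] //.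
have yw : y == w.
  apply: contraR yN2 => yw; move: (zR2); rewrite !inE => cz.
  apply: connect_trans cz (connect1 _); rewrite /r /= !inE yw yR.
  by have:= R2R z zR2; rewrite !inE => ->; rewrite edge_sym.
split=> //; move/eqP: yw eyz => -> ewz; apply: contraT => zc.
(* r' drops the oriented edge zw only, and z still reaches w through c. *)
pose r' := [rel a b | edge a b && ((a, b) != (z, w) :> G * G)].
suff: r' z w by rewrite /= eqxx andbF.
apply: (@acyclic_chord r' _ _ _ _ ewz) => [a b /andP[]//|].
apply: (@connect_trans _ _ c); last first.
  by apply: connect1; rewrite /= edge_sym ewc xpair_eqE eq_sym (negPf zc).
move: zR2; rewrite inE sr; apply: connect_sub => a b.
rewrite /r /= !inE => /and3P[_ /andP[bw _] eab]; apply: connect1.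
by rewrite /= eab xpair_eqE (negPf bw) andbF.
Qed.

(** An induced edge missing from a connected subgraph would close a cycle with
    the path joining its ends; so a subtree is determined by its vertices. *)
Lemma subtree_edgesE (H : subgraph G) :
  subtree H ->
  H.2 = [set u | [&& u.1 \in H.1, u.2 \in H.1 & edge u.1 u.2]].
Proof.
case: H => V E /and3P[/= sH _ cH]; apply/setP => -[x y]; rewrite inE /=.
have EP a b : (a, b) \in E -> [&& edge a b, a \in V, b \in V & (b, a) \in E].
  by move/forallP: sH => /(_ a)/forallP/(_ b)/implyP.
apply/idP/and3P => [/EP/and4P[] //|[xV yV exy]].
apply: (@acyclic_chord [rel x y | (x, y) \in E]).
- by move=> a b /EP/and4P[].
- by move/forall_inP: cH => /(_ x xV)/forall_inP/(_ y yV).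
- by rewrite edge_sym.
Qed.

Lemma sum_subtree (V : nmodType) (F : nat -> V) :
  \sum_(H : subgraph G | subtree H) F (subgraph_order H) =
  \sum_(S : {set G} | connected_set (@edge G) S) F #|S|.
Proof.
pose h (S : {set G}) : subgraph G :=
  (S, [set u | [&& u.1 \in S, u.2 \in S & edge u.1 u.2]]).
rewrite (reindex_onto h fst) /=; last first.
  by move=> [S E] sH; rewrite /h -(subtree_edgesE sH).
apply: eq_bigl => S; rewrite eqxx andbT /subtree /connected_set /=.
have -> /= : is_subgraph (h S).
  apply/forallP => a; apply/forallP => b; apply/implyP; rewrite !inE /=.
  by case/and3P=> -> -> eab; rewrite eab edge_sym.
congr (_ && _); apply: eq_forallb_in => x _; apply: eq_forallb_in => y _.
by apply: eq_connect => a b; rewrite /= inE.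
Qed.

Lemma mean_subtree_orderE :
  mean_subtree_order G =
  (subtree_poly (@edge G) setT)^`().[1] / (subtree_poly (@edge G) setT).[1].
Proof.
have WE : subtree_poly (@edge G) setT =
    \sum_(S : {set G} | connected_set (@edge G) S) 'X^#|S|.
  by apply: eq_bigl => S; rewrite subsetT.
rewrite /mean_subtree_order WE natr_sum !horner_sum; congr (_ / _).
  rewrite [in RHS]raddf_sum /= horner_sum (sum_subtree (fun k => k%:R)).
  apply: eq_bigr => S _.
  by rewrite derivXn hornerMn hornerXn expr1n.
rewrite -sum1_card natr_sum.
under eq_bigl => H do rewrite inE.
rewrite (sum_subtree (fun=> 1)); apply: eq_bigr => S _.
by rewrite hornerXn expr1n.
Qed.

End Acyclic.

(** * Jamison's inequality *)

(** Here P and W stand for the generating polynomials of the subtrees through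
    the root and of all subtrees, and k for the order of the tree.  The last
    clause is Jamison's inequality; the others are needed to carry it through
    the induction and to compare means afterwards. *)
Definition rooted_bounds (k : nat) (P W : {poly rat}) :=
  let a := P.[1] in let A := P^`().[1] in
  let t := W.[1] in let M := W^`().[1] in
  [/\ k%:R <= a <= t, A <= a ^+ 2, 2 * a - 1 <= A <= M & M * a <= A * t].

Lemma rooted_bounds_join k1 k2 P1 P2 W1 W2 :
  (0 < k1)%N -> (0 < k2)%N ->
  rooted_bounds k1 P1 W1 -> rooted_bounds k2 P2 W2 ->
  rooted_bounds (k1 + k2) (P1 * (1 + P2)) (W1 + W2 + P1 * P2).
Proof.
rewrite -(ler1n rat) -(ler1n rat k2) /rooted_bounds natrD !derivE !hornerE /=.
move: P1.[1] P1^`().[1] W1.[1] W1^`().[1] => a1 A1 t1 M1.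
move: P2.[1] P2^`().[1] W2.[1] W2^`().[1] => a2 A2 t2 M2.
move: k1%:R k2%:R => x1 x2 x1_ge1 x2_ge1.
case=> /andP[xa1 at1] Aa1 /andP[aA1 AM1] MA1.
case=> /andP[xa2 at2] Aa2 /andP[aA2 AM2] MA2.
have [a1_ge1 a2_ge1] : 1 <= a1 /\ 1 <= a2 by lra.
have [aA1' aA2'] : a1 <= A1 /\ a2 <= A2 by lra.
have a12_1 : a1 <= a1 * a2 by nra.
have a12_2 : a2 <= a1 * a2 by nra.
have aA_ge : a1 * (2 * a2 - 1) <= a1 * A2 by nra.
have Aa_ge : (2 * a1 - 1) * a2 <= A1 * a2 by nra.
split.
- by apply/andP; split; nra.
- have h1 : A1 * (1 + a2) <= a1 ^+ 2 * (1 + a2) by nra.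
  have h2 : a1 * A2 <= a1 ^+ 2 * a2 ^+ 2 by nra.
  nra.
- by apply/andP; split; nra.
(* The mean at w becomes A1 / a1 + A2 / (1 + a2), at least the mean A2 / a2
   at c: the second term falls short by A2 / (a2 (1 + a2)) < 1 <= A1 / a1. *)
have root_ge : A2 * (a1 * (1 + a2)) <= (A1 * (1 + a2) + a1 * A2) * a2.
  have h : a1 * A2 <= A1 * (a2 * (1 + a2)) by apply: ler_pM; nra.
  nra.
(* The last inequality is split along W1 + W2 + P1 * P2.  The crossing sets
   alone lose a1 ^+ 2 * A2, which part3 recovers from the sets inside R1. *)
have part1 : M1 * (a1 * (1 + a2)) <= A1 * (1 + a2) * t1 by nra.
have part2 : M2 * (a1 * (1 + a2)) <= (A1 * (1 + a2) + a1 * A2) * t2.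
  rewrite -(ler_pM2r (_ : 0 < a2)); last by lra.
  have h1 : M2 * a2 * (a1 * (1 + a2)) <= A2 * t2 * (a1 * (1 + a2)).
    by apply: ler_wpM2r => //; nra.
  have h2 : A2 * (a1 * (1 + a2)) * t2 <= (A1 * (1 + a2) + a1 * A2) * a2 * t2.
    by apply: ler_wpM2r => //; lra.
  nra.
have part3 : a1 * A2 * a1 <= a1 * A2 * t1 by apply: ler_wpM2l => //; nra.
nra.
Qed.

(** By induction on #|R|, cutting R at an edge incident with w. *)
Lemma rooted_boundsP (G : sgraph) (R : {set G}) w :
  acyclic_graph G -> connected_set (@edge G) R -> w \in R ->
  rooted_bounds #|R| (rooted_poly (@edge G) R w) (subtree_poly (@edge G) R).
Proof.
move=> acG; have [m] := ubnP #|R|; elim: m => // m IHm in R w *.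
rewrite ltnS => Rm cR wR.
have [->|Rw] := eqVneq R [set w].
  rewrite /rooted_bounds rooted_poly1 subtree_poly1 cards1 derivX.
  rewrite hornerX hornerC.
  by split=> //; lra.
have [c [R1 [R2 [RE J]]]] := acyclic_split acG cR wR Rw.
have J' := joined_sym (@edge_sym G) J; have [d wR1 cR2 _] := J.
have R1_gt0 : (0 < #|R1|)%N by apply/card_gt0P; exists w.
have R2_gt0 : (0 < #|R2|)%N by apply/card_gt0P; exists c.
have cardR : #|R| = (#|R1| + #|R2|)%N.
  by rewrite RE; apply/eqP; rewrite (leq_card_setU R1 R2).2.
rewrite RE in cR; rewrite cardR in Rm; rewrite cardR RE.
rewrite (rooted_poly_join (@edge_sym G) J) (subtree_poly_join (@edge_sym G) J).
apply: rooted_bounds_join => //; apply: IHm => //.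
- by apply: leq_trans Rm; rewrite -addn1 leq_add2l.
- exact: joined_connected_part (@edge_sym G) J _ _ wR1 cR.
- by apply: leq_trans Rm; rewrite -add1n leq_add2r.
- rewrite setUC in cR.
  exact: joined_connected_part (@edge_sym G) J' _ _ cR2 cR.
Qed.

(** * Moving a leaf *)

(** The two polynomials are the generating polynomials of the tree with a path
    of order 2, respectively two leaves, attached to the root; their shape is
    the one produced by subtree_poly_join and rooted_poly_join. *)
Lemma pendant_path_vs_cherry (k : nat) (P W : {poly rat}) :
  (1 < k)%N -> rooted_bounds k P W ->
  let path := W + ('X + 'X + 'X * 'X) + P * ('X * (1 + 'X)) in
  let cherry := W + 'X + P * 'X + 'X + P * (1 + 'X) * 'X in
  path^`().[1] / path.[1] < cherry^`().[1] / cherry.[1].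
Proof.
rewrite -(ltr_nat rat) /rooted_bounds !derivE !hornerE /=.
move: P.[1] P^`().[1] W.[1] W^`().[1] k%:R => a A t M x.
move=> x_gt1 [/andP[xa at_] Aa /andP[aA AM] MA].
rewrite ltr_pdivrMr; last by lra.
rewrite [ltRHS]mulrAC ltr_pdivlMr; last by lra.
have h : a * (t - a) >= 0 by apply: mulr_ge0; lra.
nra.
Qed.

Section MoveLeaf.
Variables (T : sgraph) (v w : T).
Hypothesis vw : v != w.

Definition move_leaf_edge : rel T := fun x y =>
  [|| [&& x != v, y != v & edge x y],
      (x == v) && (y == w) | (x == w) && (y == v)].

Lemma move_leaf_sym : symmetric move_leaf_edge.
Proof.
move=> x y; rewrite /move_leaf_edge edge_sym andbCA; congr (_ || _).
by rewrite orbC; congr (_ || _); rewrite andbC.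
Qed.

Lemma move_leaf_irrefl : irreflexive move_leaf_edge.
Proof.
move=> x; rewrite /move_leaf_edge edge_irrefl !andbF /=.
by case: eqP => [->|_]; rewrite ?(negPf vw) ?andbF.
Qed.

Definition move_leaf := SGraph move_leaf_sym move_leaf_irrefl.

Lemma move_leaf_nbr x : move_leaf_edge v x = (x == w).
Proof. by rewrite /move_leaf_edge eqxx /= (negPf vw) orbF. Qed.

Lemma move_leafE x y :
  x != v -> y != v -> move_leaf_edge x y = edge x y.
Proof.
move=> xv yv; rewrite /move_leaf_edge xv yv.
by rewrite (negPf xv) (negPf yv) andbF !orbF.
Qed.

(** A cycle of the new graph avoids v, whose only neighbour is w, and so it was
    already a cycle. *)
Lemma move_leaf_acyclic : acyclic_graph T -> acyclic_graph move_leaf.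
Proof.
move=> acT c c2 uc.
have [vc|vNc] := boolP (v \in c).
  have [i p rc] := rot_to vc.
  move: uc c2; rewrite /ucycle -(rot_cycle i) -(rot_uniq i) -(size_rot i) rc.
  case: p {rc} => [|x p] //=; case/lastP: p => [|p y] //=.
  rewrite !rcons_path last_rcons /= [move_leaf_edge y v]move_leaf_sym.
  rewrite !move_leaf_nbr.
  case/andP=> /andP[/eqP-> /andP[_ /eqP->]].
  by rewrite mem_rcons inE eqxx !andbF.
apply: (acT c c2); case/andP: uc => cc uc; apply/andP; split=> //.
have Nv x : x \in c -> x != v by move=> xc; apply: contraNneq vNc => <-.
apply: (@sub_in_cycle _ (mem c) (@edge move_leaf) (@edge T) _ c _ cc).
  by move=> x y /Nv xv /Nv yv; rewrite /= move_leafE.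
by apply/allP.
Qed.

End MoveLeaf.

Lemma connected_setT (G : sgraph) :
  (0 < #|G|)%N -> connected_graph G <-> connected_set (@edge G) setT.
Proof.
move=> G0; have E : within (@edge G) setT =2 @edge G.
  by move=> x y; rewrite /= !inE.
split=> [cG|/connected_setP[_ cG] x y]; last first.
  by have := cG x y (in_setT x) (in_setT y); rewrite (eq_connect E).
apply/connected_setP; split; last by move=> x y _ _; rewrite (eq_connect E).
by have /card_gt0P[x _] := G0; apply/set0Pn; exists x.
Qed.

(** If the neighbour of v had degree 2, with second neighbour w,
    reattaching v to w would give a
    tree of the same order with a larger mean. *)
Lemma optimal_leaf_nbr (n : nat) (T : sgraph) (v : T) :
  (4 <= n)%N -> optimal (trees_of_order n) T -> leaf v ->
  exists2 u : T, edge v u & (3 <= degree u)%N.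
Proof.
move=> n4 [[[T0 cT acT] Tn] opt] /cards1P[u Nv].
have NvE x : edge v x = (x == u) by have := in_set1 x u; rewrite -Nv inE.
have evu : edge v u by rewrite NvE.
exists u => //; rewrite leqNgt; apply/negP => Nu.
have uv : u != v by apply: contraTneq evu => ->; rewrite edge_irrefl.
have cTs : connected_set (@edge T) setT by apply/connected_setT.
have J0 : joined (@edge T) [set u] [set v] u v.
  split; rewrite ?inE ?disjoints1 ?inE // => x y /set1P-> /set1P->.
  by rewrite edge_sym evu !eqxx.
pose R := ~: [set u; v].
have RT : setT = R :|: [set u; v] by rewrite setUC setUCr.
have cardR : (1 < #|R|)%N.
  have := cardsC [set u; v]; rewrite cards2 uv -/R Tn => nE.
  by rewrite -(ltn_add2l 2) nE.
(* Otherwise {u, v} would be a component of T, of order 2 < n. *)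
have [w wR euw] : exists2 w, w \in R & edge u w.
  have /card_gt0P[z zR] := ltnW cardR.
  apply/exists_inP; apply: contraTT (cT u z) => /exists_inPn NR.
  have cl : closed (@edge T) (mem [set u; v]).
    apply: intro_closed => [|x y]; first exact: sym_connect_sym (@edge_sym T).
    rewrite !inE => exy /orP[] /eqP xE; rewrite xE in exy.
      by apply: contraTT exy => Ny; apply: NR; rewrite !inE.
    by rewrite -NvE exy.
  apply/negP => /(closed_connect cl); rewrite /= !inE eqxx /=.
  by move/esym; move: zR; rewrite !inE => /negPf->.
have wNv : v != w by rewrite eq_sym; move: wR; rewrite !inE negb_or => /andP[].
have NuE x : edge u x = (x == v) || (x == w).
  have /eqP E : [set v; w] == [set y | edge u y].
    rewrite eqEcard cards2 wNv -ltnS Nu andbT; apply/subsetP => y.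
    by rewrite !inE => /orP[] /eqP-> //; rewrite edge_sym.
  by have := in_set2 x v w; rewrite E inE.
(* T is R joined by uw to the path uv, itself u joined to v; T' is R joined to
   u and then to v, both times at w. *)
have J : joined (@edge T) R [set u; v] w u.
  split=> //; rewrite ?inE ?eqxx //.
    by rewrite -setI_eq0 setIC setICr.
  move=> x y; rewrite !inE negb_or => /andP[xu xv] /orP[]/eqP->.
    by rewrite edge_sym NuE (negPf xv) eqxx andbT.
  by rewrite edge_sym NvE (negPf xu) [v == u]eq_sym (negPf uv) andbF.
have cR : connected_set (@edge T) R.
  by rewrite RT in cTs; exact: joined_connected_part (@edge_sym T) J _ _ wR cTs.
have wTE : mean_subtree_order T = _ := mean_subtree_orderE acT.
rewrite RT (subtree_poly_join (@edge_sym T) J) in wTE.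
rewrite (subtree_poly_join (@edge_sym T) J0) !subtree_poly1 in wTE.
rewrite (rooted_poly_join (@edge_sym T) J0) !rooted_poly1 in wTE.
pose T' := move_leaf wNv.
have T'E (x y : T) : x != v -> y != v -> @edge T' x y = @edge T x y.
  exact: move_leafE.
have NvE' (x : T) : @edge T' v x = (x == w) by exact: move_leaf_nbr.
have eR : {in R &, forall x y : T, @edge T' x y = @edge T x y}.
  move=> x y; rewrite !inE !negb_or => /andP[_ xv] /andP[_ yv].
  exact: T'E.
have J1 : joined (@edge T') R [set u] w u.
  have [_ _ _ E] := J; split; rewrite ?set11 //.
    by rewrite disjoint_sym disjoints1 !inE eqxx.
  move=> x _ xR /set1P->; rewrite T'E //.
    by rewrite E // !inE eqxx.
  by move: xR; rewrite !inE negb_or => /andP[].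
have J2 : joined (@edge T') (R :|: [set u]) [set v] w v.
  split; rewrite ?set11 //.
    by rewrite disjoint_sym disjoints1 !inE eqxx orbT /= eq_sym.
    by rewrite inE wR.
  move=> x _ _ /set1P->; rewrite edge_sym NvE'.
  by rewrite eqxx andbT.
have RT' : (setT : {set T'}) = R :|: [set u] :|: [set v] by rewrite -setUA.
have cRu : connected_set (@edge T') (R :|: [set u]).
  rewrite (connected_set_join (@edge_sym T') J1) ?subxx //.
  - by rewrite wR (eq_connected_set eR) cR set11 connected_set1.
  - by apply/set0Pn; exists w.
  - by apply/set0Pn; exists u; rewrite set11.
have cT' : connected_set (@edge T') setT.
  rewrite RT' (connected_set_join (@edge_sym T') J2) ?subxx //.
  - by rewrite cRu set11 connected_set1 inE wR.
  - by apply/set0Pn; exists w; rewrite inE wR.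
  - by apply/set0Pn; exists v; rewrite set11.
have acT' : acyclic_graph T' by apply: move_leaf_acyclic.
have tT' : trees_of_order n T'.
  by split=> //; split=> //; apply/connected_setT.
have wTE' : mean_subtree_order T' = _ := mean_subtree_orderE acT'.
rewrite RT' (subtree_poly_join (@edge_sym T') J2) in wTE'.
rewrite (subtree_poly_join (@edge_sym T') J1) !subtree_poly1 in wTE'.
rewrite (rooted_poly_join (@edge_sym T') J1) !rooted_poly1 in wTE'.
rewrite (eq_subtree_poly eR) (eq_rooted_poly _ eR) in wTE'.
have := opt T' tT'; rewrite wTE wTE' leNgt => /negP; apply.
exact: pendant_path_vs_cherry cardR (rooted_boundsP acT cR wR).
Qed.

Lemma seq_nbr (T : eqType) (e : rel T) (p : seq T) v :
  symmetric e -> sorted e p -> v \in p -> (1 < size p)%N ->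
  exists2 y, y \in p & e v y.
Proof.
move=> se + vp; case/splitPr: vp => p1 [|y p2].
  case/lastP: p1 => [|p1 y] //; rewrite cat_rcons sorted_cat_cons.
  case/andP=> _ /=; rewrite andbT => eyv _; exists y; last by rewrite se.
  by rewrite mem_cat inE eqxx orbT.
rewrite sorted_cat_cons => /andP[_ /= /andP[evy _]] _; exists y => //.
by rewrite mem_cat !inE eqxx !orbT.
Qed.

Local Close Scope ring_scope.

Theorem theorem3p9 (n : nat) (hn : 4 <= n) (T : sgraph)
    (hT : optimal (trees_of_order n) T) :
  (forall L : subgraph T, limb L -> subgraph_order L = 1) /\
  (forall v : T, leaf v -> exists2 u : T, edge v u & 3 <= degree u).
Proof.
(* A limb with two vertices contains, next to its leaf, the neighbour of that
   leaf, whose degree is too large for a limb. *)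
split=> [L|v lv]; last exact: optimal_leaf_nbr hn hT lv.
case=> -[[p [p0 up sp ->]] [v vp lv] deg2] _; rewrite /= !inE in vp deg2 *.
rewrite /subgraph_order /= cardsE (card_uniqP up).
have p_gt0 : 0 < size p by case: (p) p0.
apply/eqP; rewrite eqn_leq p_gt0 andbT leqNgt; apply/negP => p_gt1.
have [u evu] := optimal_leaf_nbr hn hT lv; rewrite leqNgt => /negP; apply.
have [y yp evy] := seq_nbr (@edge_sym T) sp vp p_gt1.
have /cards1P[z zE] := lv.
have Nz x : edge v x -> x = z.
  by move=> ex; apply/set1P; rewrite -zE inE.
by rewrite (Nz _ evu) -(Nz _ evy) ltnS; apply: deg2; rewrite inE.
Qed.
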